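(* For a (Tychonoff) space $X$ the following are equivalent: (a) $X$ is a finite $C$-space; (b) every sequence $\{\omega_n\}_{n\in\mathbb N}$ of locally finite covers of $X$ by functionally open sets has a finite $C$-refinement $\{\gamma_n\}_{n=1}^s$ such that $\bigcup_{n=1}^s\gamma_n$ is a locally finite cover of $X$ consisting of functionally open sets.
   Context: A set is functionally open if it is a cozero set. A finite $C$-refinement of a sequence of covers $\{\omega_n\}$ is a finite sequence $\gamma_1,\dots,\gamma_s$ of families of open sets, each $\gamma_n$ consisting of pairwise disjoint sets and refining $\omega_n$, such that $\bigcup_{n=1}^s\gamma_n$ covers $X$. $X$ is a finite $C$-space if every sequence of finite covers of $X$ by functionally open sets has a finite $C$-refinement in which each $\gamma_n$ is a finite family of pairwise disjoint functionally open sets. *)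

(* Defs.v *)
From mathcomp Require Import all_boot all_order all_algebra.
From mathcomp Require Import all_classical all_reals all_analysis.
From mathcomp Require Import Rstruct Rstruct_topology.
From Stdlib Require Import Rdefinitions.
Set Implicit Arguments. Unset Strict Implicit. Unset Printing Implicit Defensive.
Import Order.TTheory GRing.Theory Num.Theory.
Local Open Scope classical_set_scope.


Section Defs.
Variable X : topologicalType.

Definition tychonoff_space : Prop :=
  completely_regular_space X /\ hausdorff_space X.

Definition functionally_open (U : set X) : Prop :=
  exists f : X -> Rdefinitions.R, continuous f /\ U = [set x | f x != 0%R].

Definition is_cover (F : set (set X)) : Prop :=
  forall x : X, exists U, F U /\ U x.

Definition refines (G F : set (set X)) : Prop :=
  forall U, G U -> exists V, F V /\ U `<=` V.

Definition pairwise_disjoint_family (G : set (set X)) : Prop :=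
  forall U V, G U -> G V -> U <> V -> U `&` V = set0.

Definition locally_finite_family (F : set (set X)) : Prop :=
  forall x : X, exists N, nbhs x N /\ finite_set [set U | F U /\ U `&` N !=set0].

Definition finite_C_refinement (omega : nat -> set (set X)) (s : nat)
    (gamma : nat -> set (set X)) : Prop :=
  (forall n : nat, (n < s)%N ->
     (forall U, gamma n U -> open U) /\
     pairwise_disjoint_family (gamma n) /\
     refines (gamma n) (omega n)) /\
  is_cover (\bigcup_(n in [set n : nat | (n < s)%N]) gamma n).

Definition finite_C_space : Prop :=
  forall omega : nat -> set (set X),
    (forall n, finite_set (omega n) /\
               (forall U, omega n U -> functionally_open U) /\
               is_cover (omega n)) ->
    exists (s : nat) (gamma : nat -> set (set X)),
      finite_C_refinement omega s gamma /\
      (forall n : nat, (n < s)%N ->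
         finite_set (gamma n) /\ (forall U, gamma n U -> functionally_open U)).

End Defs.

(* Main.v *)
(* From (a) to (b): after passing to common refinements, each [omega n] is replaced by a
   countable cover: with cozero witnesses [f U], the sets where the [f U] with [U \in A],
   [#|A| = i], dominate all the others are disjoint for fixed [i]; [O n i] is their union.
   A countable cover has a continuous height function [h n] such that each sublevel set
   [h n <= c] is covered by finitely many [O n i].  In a finite C-space the set [c <= h n]
   has finite covering dimension for large [c]: otherwise, on a discrete sequence of layers
   of [h n], there would be longer and longer tuples of two-element covers without disjoint
   refinements, and these combine to a sequence of two-element covers of [X].  Hence the
   finite C-property, applied to the finite covers made of [c n < h n] and finitely many
   [O n i], leaves uncovered only a set of finite dimension [< d], and over such a set any
   further cover is refined by [2 * d] disjoint families: [d] over the layers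
   [i <= h <= i + 1/2], and [d] over the complementary ones. *)
Require Import Defs.
From mathcomp Require Import all_boot all_order all_algebra.
From mathcomp Require Import finmap lra.
From mathcomp Require Import all_classical all_reals all_analysis.
From mathcomp Require Import Rstruct Rstruct_topology.
Import Order.TTheory GRing.Theory Num.Theory.
Import numFieldNormedType.Exports.
Local Open Scope classical_set_scope.

Set Implicit Arguments.
Unset Strict Implicit.
Unset Printing Implicit Defensive.

Local Notation R := Rdefinitions.R.
Local Notation fo := functionally_open.

(** * Equicontinuous families of functions and the algebra of cozero sets *)

Section EquicontinuousFamilies.
Local Open Scope ring_scope.
Variable X : topologicalType.

(** One neighbourhood serves all indices at once, so suprema over arbitrary index sets stay
    continuous. *)
Definition equicontinuous_unit (T : Type) (f : T -> X -> R) : Prop :=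
  (forall t x, 0 <= f t x <= 1) /\
  (forall x (e : R), 0 < e -> \forall y \near x, forall t, `|f t x - f t y| <= e).

Lemma continuous_near_le (F : X -> R) :
  (forall x (e : R), 0 < e -> \forall y \near x, `|F x - F y| <= e) ->
  continuous F.
Proof. by move=> H x; apply/(@cvgrPdist_le _ R^o) => e e0; exact: H. Qed.

Lemma near_le_continuous (F : X -> R) : continuous F ->
  forall x (e : R), 0 < e -> \forall y \near x, `|F x - F y| <= e.
Proof. by move=> H x e e0; move: (H x) => /(@cvgrPdist_le _ R^o); apply. Qed.

(** For empty [A] the value is the default 0 of [sup], which suits functions with values in
    [0, 1]. *)
Definition supf (T : Type) (f : T -> X -> R) (A : set T) (x : X) : R :=
  sup [set f t x | t in A].

Lemma supf_ge (T : Type) (f : T -> X -> R) (A : set T) t x :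
  (forall t x, 0 <= f t x <= 1) -> A t -> f t x <= supf f A x.
Proof.
move=> f01 At; apply: ub_le_sup; last by exists t.
by exists 1 => _ [u _ <-]; case/andP: (f01 u x).
Qed.

Lemma supf_le (T : Type) (f : T -> X -> R) (A : set T) x (c : R) :
  0 <= c -> (forall t, A t -> f t x <= c) -> supf f A x <= c.
Proof.
move=> c0 H; have [[t At]|/set0P/negP/negPn/eqP A0] := pselect (A !=set0).
  by apply: ge_sup; [exists (f t x), t | move=> _ [u Au <-]; exact: H].
by rewrite /supf A0 image_set0 sup0.
Qed.

Lemma supf_ge0 (T : Type) (f : T -> X -> R) (A : set T) x :
  (forall t x, 0 <= f t x <= 1) -> 0 <= supf f A x.
Proof.
move=> f01; have [[t At]|/set0P/negP/negPn/eqP A0] := pselect (A !=set0).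
  by apply: le_trans (supf_ge x f01 At); case/andP: (f01 t x).
by rewrite /supf A0 image_set0 sup0.
Qed.

Lemma supf_gt (T : Type) (f : T -> X -> R) (A : set T) x (c : R) :
  0 <= c -> c < supf f A x -> exists2 t, A t & c < f t x.
Proof.
move=> c0; apply: contraPP => /forall2NP H; apply/negP; rewrite -leNgt.
by apply: supf_le => // t At; case: (H t) => // /negP; rewrite -leNgt.
Qed.

(** The neighbourhood is chosen before [A], so the suprema are again equicontinuous, now with [A] as
    index. *)
Lemma supf_near (T : Type) (f : T -> X -> R) x (e : R) :
  equicontinuous_unit f -> 0 < e ->
  \forall y \near x, forall A, `|supf f A x - supf f A y| <= e.
Proof.
move=> [f01 fe] e0; near=> y => A.
have h : forall t, `|f t x - f t y| <= e by near: y; exact: fe.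
have xy : supf f A x <= supf f A y + e.
  apply: supf_le => [|t At]; first by have := supf_ge0 A y f01; lra.
  by have := supf_ge y f01 At; have := h t; rewrite ler_norml; lra.
have yx : supf f A y <= supf f A x + e.
  apply: supf_le => [|t At]; first by have := supf_ge0 A x f01; lra.
  by have := supf_ge x f01 At; have := h t; rewrite ler_norml; lra.
by rewrite ler_norml; lra.
Unshelve. all: by end_near. Qed.

Lemma supf_continuous (T : Type) (f : T -> X -> R) (A : set T) :
  equicontinuous_unit f -> continuous (supf f A).
Proof.
move=> fE; apply: continuous_near_le => x e e0.
by apply: filterS (supf_near x fE e0) => y; apply.
Qed.

Lemma functionally_openE (U : set X) :
  fo U = (exists f : X -> R, continuous f /\ U = [set x | f x != 0]).
Proof. by []. Qed.

Lemma fo_lt (u v : X -> R) :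
  continuous u -> continuous v -> fo [set x | u x < v x].
Proof.
move=> cu cv; rewrite functionally_openE; exists (fun x => Num.max 0 (v x - u x)); split.
  apply: continuous_near_le => x e e0; near=> y.
  have hu : `|u x - u y| <= e / 2.
    by near: y; apply: near_le_continuous => //; lra.
  have hv : `|v x - v y| <= e / 2.
    by near: y; apply: near_le_continuous => //; lra.
  move: hu hv; rewrite !ler_norml => hu hv.
  by case: (leP 0 (v x - u x)) => ?; case: (leP 0 (v y - u y)) => ?; lra.
apply/seteqP; split => x /=.
  by move=> h; case: (leP 0 (v x - u x)) => ?; apply/eqP; lra.
by case: (leP 0 (v x - u x)) => [? /eqP ?|? /eqP]; lra.
Unshelve. all: by end_near. Qed.

Lemma fo_bigcup_equicontinuous (T : Type) (f : T -> X -> R) (A : set T) :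
  equicontinuous_unit f -> fo [set x | exists2 t, A t & 0 < f t x].
Proof.
move=> fE; have : fo [set x | cst 0 x < supf f A x].
  by apply: fo_lt; [move=> ?; exact: cvg_cst | exact: supf_continuous].
congr fo; apply/seteqP; split => x /= => [/supf_gt|[t At ft]]; first exact.
by apply: lt_le_trans ft _; apply: supf_ge => //; case: fE.
Qed.

Lemma fo_witness (U : set X) : fo U -> exists f : X -> R,
  [/\ continuous f, forall x, 0 <= f x <= 1 & forall x, U x <-> 0 < f x].
Proof.
rewrite functionally_openE => -[f [cf ->]]; exists (fun x => Num.min `|f x| 1); split.
- apply: continuous_near_le => x e e0; near=> y.
  have : `|f x - f y| <= e by near: y; exact: near_le_continuous.
  move=> /(le_trans (ler_dist_dist (f x) (f y))).
  rewrite !ler_norml => ?.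
  by case: (leP `|f x| 1) => ?; case: (leP `|f y| 1) => ?; lra.
- by move=> x; have := normr_ge0 (f x); case: (leP `|f x| 1) => ? ?; apply/andP; split; lra.
- move=> x /=; rewrite -normr_gt0.
  by case: (leP `|f x| 1) => ?; split=> // ?; lra.
Unshelve. all: by end_near. Qed.

Lemma near_finite_set (T : choiceType) (D : set T) (P : T -> X -> Prop) (x : X) :
  finite_set D -> (forall t, D t -> \forall y \near x, P t y) ->
  \forall y \near x, forall t, D t -> P t y.
Proof.
move=> /finite_fsetP[A ->] H.
have : \forall y \near x, (\bigcap_(t in [set` A]) [set y | P t y]) y.
  by apply: filter_bigI => t tA; exact: H.
by apply: filterS => y + t; apply.
Qed.

(** Near a given point all but finitely many witnesses vanish identically. *)
Lemma equicontinuous_locally_finite (T : choiceType) (O : T -> set X) :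
  (forall t, fo (O t)) ->
  (forall x : X, exists N, nbhs x N /\ finite_set [set t | O t `&` N !=set0]) ->
  exists f : T -> X -> R, equicontinuous_unit f /\
    forall t x, O t x <-> 0 < f t x.
Proof.
move=> foO lf.
have /choice[f Hf] : forall t, exists f : X -> R,
    [/\ continuous f, forall x, 0 <= f x <= 1 & forall x, O t x <-> 0 < f x].
  by move=> t; exact: fo_witness.
have f01 t x : 0 <= f t x <= 1 by case: (Hf t).
exists f; split; last by move=> t; case: (Hf t).
split=> // x e e0; have [N [Nx finN]] := lf x.
have : \forall y \near x, forall t, [set t | O t `&` N !=set0] t ->
    `|f t x - f t y| <= e.
  apply: near_finite_set => // t _.
  by case: (Hf t) => cf _ _; exact: near_le_continuous.
move=> nearF; near=> y => t.
have yN : N y by near: y.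
have [ht|ht] := pselect (O t `&` N !=set0); first by move: t ht; near: y.
have zero z : N z -> f t z = 0.
  move=> Nz; apply/eqP; rewrite eq_le; case/andP: (f01 t z) => -> _.
  rewrite andbT leNgt; apply/negP => fz; apply: ht; exists z; split => //.
  by case: (Hf t) => _ _ ->.
rewrite !zero ?subrr ?normr0 ?ltW //; exact: nbhs_singleton Nx.
Unshelve. all: by end_near. Qed.

(** Truncated at [1 / (n + 1)], only finitely many witnesses can vary by more than [e]. The
    truncation bound later yields the height function. *)
Lemma equicontinuous_countable (O : nat -> set X) :
  (forall n, fo (O n)) ->
  exists f : nat -> X -> R, [/\ equicontinuous_unit f,
    forall n x, O n x <-> 0 < f n x & forall n x, f n x <= n.+1%:R^-1].
Proof.
move=> foO.
have /choice[g Hg] : forall n, exists f : X -> R,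
    [/\ continuous f, forall x, 0 <= f x <= 1 & forall x, O n x <-> 0 < f x].
  by move=> n; exact: fo_witness.
have i0 n : 0 < n.+1%:R^-1 :> R by rewrite invr_gt0 ltr0n.
have g01 n x : 0 <= g n x <= 1 by case: (Hg n).
exists (fun n x => Num.min (g n x) n.+1%:R^-1); split; last first.
- by move=> n x; rewrite ge_min lexx orbT.
- by move=> n x; rewrite lt_min i0 andbT; case: (Hg n).
split.
  move=> n x; rewrite le_min ge_min; case/andP: (g01 n x) => -> ->.
  by rewrite (ltW (i0 n)).
move=> x e e0; pose N := Num.truncn e^-1.
have Ne n : (N <= n)%N -> n.+1%:R^-1 <= e.
  move=> Nn; rewrite -[leRHS]invrK lef_pV2 ?posrE ?invr_gt0 ?ltr0n//.
  by apply/ltW/(lt_le_trans (truncnS_gt _)); rewrite ler_nat.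
have nearF : \forall y \near x, forall n, `I_N n -> `|g n x - g n y| <= e.
  apply: near_finite_set; first exact: finite_II.
  by move=> n _; case: (Hg n) => cg _ _; exact: near_le_continuous.
apply: filterS nearF => y Hy n.
have := g01 n x; have := g01 n y; have := i0 n; have := Ne n; have := Hy n.
move: n.+1%:R^-1 => c /=.
have [nN|Nn] := ltnP n N.
  move=> /(_ isT) + _; rewrite !ler_norml.
  by case: (leP (g n x) c) => ?; case: (leP (g n y) c) => ?; lra.
move=> _ /(_ isT); rewrite !ler_norml.
by case: (leP (g n x) c) => ?; case: (leP (g n y) c) => ?; lra.
Qed.

Lemma fo_set0 : fo (set0 : set X).
Proof.
rewrite functionally_openE; exists (cst 0); split.
  by move=> ?; exact: cvg_cst.
by apply/seteqP; split => x //=; rewrite eqxx.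
Qed.

Lemma fo_setT : fo (setT : set X).
Proof.
rewrite functionally_openE; exists (cst 1); split.
  by move=> ?; exact: cvg_cst.
by apply/seteqP; split => x //= _; rewrite oner_neq0.
Qed.

Lemma fo_bigcup_nat (O : nat -> set X) :
  (forall n, fo (O n)) -> fo (\bigcup_n O n).
Proof.
move=> /equicontinuous_countable[f [fE Of _]].
have := fo_bigcup_equicontinuous setT fE; congr fo.
by apply/seteqP; split => x /= [n _ /Of]; exists n.
Qed.

Lemma fo_setU (U V : set X) : fo U -> fo V -> fo (U `|` V).
Proof.
move=> foU foV; rewrite -bigcup2E; apply: fo_bigcup_nat => -[|[|n]] //=.
exact: fo_set0.
Qed.

Lemma fo_setI (U V : set X) : fo U -> fo V -> fo (U `&` V).
Proof.
rewrite !functionally_openE => -[f [cf ->]] [g [cg ->]].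
exists (fun x => f x * g x); split.
  by move=> x; apply: (@cvgM R _ (nbhs x)); [exact: cf | exact: cg].
by apply/seteqP; split => x /=; rewrite mulf_eq0 negb_or => /andP.
Qed.

Lemma fo_bigcup_locally_finite (T : choiceType) (O : T -> set X) :
  (forall t, fo (O t)) ->
  (forall x : X, exists N, nbhs x N /\ finite_set [set t | O t `&` N !=set0]) ->
  fo (\bigcup_t O t).
Proof.
move=> foO /(equicontinuous_locally_finite foO)[f [fE Of]].
have := fo_bigcup_equicontinuous setT fE; congr fo.
by apply/seteqP; split => x /= [n _ /Of]; exists n.
Qed.

Lemma fo_open (U : set X) : fo U -> open U.
Proof.
rewrite functionally_openE => -[f [cf ->]].
have -> : [set x | f x != 0] = f @^-1` [set y : R | y != 0] by [].
apply: open_comp; first by move=> x _; exact: cf.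
exact: (@open_neq R^o).
Qed.
End EquicontinuousFamilies.

(** * Disjoint shrinkings and the levels of a family of functions *)

Section Refinements.
Variable X : topologicalType.

(** Disjointness is stated for indices, so that many indices may carry the empty set. *)
Definition shrinking (T : Type) (O e : T -> set X) : Prop :=
  [/\ forall t, fo (e t), forall t, e t `<=` O t &
      forall t u x, e t x -> e u x -> t = u].

Definition refinable (T : Type) (d : nat) (S : set X) (P : nat -> T -> set X) :=
  exists G : nat -> T -> set X, (forall j, shrinking (P j) (G j)) /\
    forall x, S x -> exists j t, (j < d)%N /\ G j t x.

Section Levels.
Local Open Scope ring_scope.
Local Open Scope fset_scope.
Variables (T : choiceType) (f : T -> X -> R).
Hypothesis fE : equicontinuous_unit f.

Let f01 : forall t x, 0 <= f t x <= 1. Proof. by case: fE. Qed.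

(** Passing to [1 - f] turns an infimum over a nonempty set into a supremum, so that [supf] serves
    for both. *)
Let cf (t : T) (x : X) : R := 1 - f t x.

Let cf01 : forall t x, 0 <= cf t x <= 1.
Proof. by move=> t x; have := f01 t x; rewrite /cf; lra. Qed.

Let cfE : equicontinuous_unit cf.
Proof.
split=> // x e e0; case: fE => _ /(_ x e e0); apply: filterS => y Hy t.
by have := Hy t; rewrite /cf !ler_norml; lra.
Qed.

(* For [A] nonempty, positive exactly where the smallest [f t] with [t \in A] exceeds the largest
   [f t] with [t \notin A]; for [A] of fixed size this happens for at most one [A]. *)
Definition level_gap (A : {fset T}) (x : X) : R :=
  1 - supf cf [set` A] x - supf f (~` [set` A]) x.

Lemma level_gap_lt (A : {fset T}) x t u :
  0 < level_gap A x -> t \in A -> u \notin A -> f u x < f t x.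
Proof.
move=> h tA uA.
have := @supf_ge _ _ cf [set` A] t x cf01 tA.
have := @supf_ge _ _ f (~` [set` A]) u x f01 (negP uA).
by move: h; rewrite /level_gap /cf; lra.
Qed.

Lemma level_gap_gt0 (A : {fset T}) x t :
  0 < level_gap A x -> t \in A -> 0 < f t x.
Proof.
move=> h tA; have := @supf_ge _ _ cf [set` A] t x cf01 tA.
have := supf_ge0 (~` [set` A]) x f01.
by move: h; rewrite /level_gap /cf; lra.
Qed.

(** Otherwise some [t] in [A] but not in [B] and some [u] in [B] but not in [A] would satisfy both
    [f u x < f t x] and [f t x < f u x]. *)
Lemma level_gap_inj (A B : {fset T}) x :
  #|` A| = #|` B| -> 0 < level_gap A x -> 0 < level_gap B x -> A = B.
Proof.
move=> AB hA hB.
have sub (C D : {fset T}) : #|` C| = #|` D| -> ~~ (C `<=` D) ->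
    exists t u, [/\ t \in C, t \notin D, u \in D & u \notin C].
  move=> CD nCD; have /fsubsetPn[t tC tD] := nCD.
  have : ~~ (D `<=` C).
    apply: contra nCD => DC.
    by have := fsubset_leqif_cards DC => -[_]; rewrite CD eqxx => /esym/eqP ->.
  by move=> /fsubsetPn[u uD uC]; exists t, u.
apply/eqP; rewrite eqEfcard AB leqnn andbT; apply/negPn/negP.
move=> /(sub A B AB)[t [u [tA tB uB uA]]].
have := level_gap_lt hA tA uA; have := level_gap_lt hB uB tB; lra.
Qed.

Lemma level_gap_equicontinuous :
  equicontinuous_unit (fun A x => Num.max 0 (level_gap A x)).
Proof.
split=> [A x|x e e0].
  have := supf_ge0 (~` [set` A]) x f01; have := supf_ge0 [set` A] x cf01.
  by case: (leP 0 (level_gap A x)); rewrite /level_gap; lra.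
have e2 : 0 < e / 2 by lra.
apply: filterS2 (supf_near x fE e2) (supf_near x cfE e2) => y Hf Hc A.
have := Hf (~` [set` A]); have := Hc [set` A].
rewrite !ler_norml => h1 h2; case: (leP 0 (level_gap A x)); case: (leP 0 (level_gap A y));
  rewrite /level_gap; lra.
Qed.

(** A positive gap of [A] makes every [f t] with [t \in A] positive; the head of [A] merely selects
    one such index. Level 0 is empty, since the empty set has no head. *)
Definition level (i : nat) (t : T) : set X :=
  [set x | exists2 A : {fset T}, #|` A| = i /\ ohead A = Some t & 0 < level_gap A x].

Lemma level_shrinking i : shrinking (fun t => [set x | 0 < f t x]) (level i).
Proof.
have headP (A : {fset T}) t : ohead A = Some t -> t \in A.
  rewrite -[t \in A]/(t \in enum_fset A); case: (enum_fset A) => //= a s [->].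
  exact: mem_head.
split.
- move=> t; have := fo_bigcup_equicontinuous
    [set A : {fset T} | #|` A| = i /\ ohead A = Some t] level_gap_equicontinuous.
  congr fo; apply/seteqP; split => x [A hA h]; exists A => //.
    by move: h; rewrite lt_max ltxx.
  by rewrite lt_max h orbT.
- by move=> t x [A [_ /headP tA]] /level_gap_gt0; apply.
- move=> t u x [A [Ai At]] hA [B [Bi Bu]] hB.
  have AB : A = B by apply: level_gap_inj hA hB; rewrite Ai.
  by move: At; rewrite AB Bu => -[].
Qed.

Lemma fo_bigcup_level i : fo (\bigcup_t level i t).
Proof.
have := fo_bigcup_equicontinuous
    [set A : {fset T} | #|` A| = i /\ exists t, ohead A = Some t] level_gap_equicontinuous.
congr fo; apply/seteqP; split => x.
  by move=> [A [Ai [t At]]]; rewrite lt_max ltxx => h; exists t => //; exists A.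
by move=> [t _ [A [Ai At] h]]; exists A; [split=> //; exists t | rewrite lt_max h orbT].
Qed.

(** With finite support the maximum at [x] is attained and exceeds the next value; [A] collects the
    indices attaining it. *)
Lemma level_cover x :
  finite_set [set t | 0 < f t x] -> (exists t, 0 < f t x) ->
  exists A : {fset T}, [/\ (0 < #|` A|)%N, forall t, t \in A -> 0 < f t x &
    exists t, level #|` A| t x].
Proof.
move=> /finite_fsetP[B BE] [t0 ft0].
have memB t : (t \in B) = (0 < f t x).
  by apply/idP/idP => [tB|ft]; [have : [set` B] t by [] | have : [set t | 0 < f t x] t by []];
    rewrite ?BE // -BE.
have t0B : t0 \in B by rewrite memB.
have nonneg t : 0 <= f t x by case/andP: (f01 t x).
pose M := \big[Num.max/0]_(t <- B) f t x.
have leM t : t \in B -> f t x <= M by move=> tB; exact: le_bigmax_seq.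
have M0 : 0 < M by exact: lt_le_trans ft0 (leM _ t0B).
pose A := [fset t in B | f t x == M]%fset.
(* The largest value below [M], or the default 0 if there is none; [M0] keeps the gap positive in
   that case too. *)
pose m := \big[Num.max/0]_(t <- B | f t x != M) f t x.
have mM : m < M.
  by rewrite /m big_seq_cond; apply: bigmax_lt => // t /andP[tB tM]; rewrite lt_neqAle tM leM.
have gapA : 0 < level_gap A x.
  have : supf cf [set` A] x <= 1 - M.
    apply: supf_le; last by move=> t /=; rewrite !inE /= => /andP[_ /eqP <-].
    rewrite subr_ge0 /M; apply: bigmax_le => // t _; by case/andP: (f01 t x).
  have : supf f (~` [set` A]) x <= m.
    apply: supf_le; first exact: bigmax_ge_id.
    move=> t /= /negP; rewrite !inE /= negb_and => /orP[|tM].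
      by rewrite memB -leNgt => /le_trans; apply; exact: bigmax_ge_id.
    have [tB|] := boolP (t \in B); first exact: le_bigmax_seq.
    by rewrite memB -leNgt => /le_trans; apply; exact: bigmax_ge_id.
  rewrite /level_gap; lra.
have [t tA] : exists t, t \in A.
  apply: contrapT => /forallNP noA; move: mM; rewrite /m /M big_seq_cond [ltRHS]big_seq.
  rewrite (eq_bigl (fun t => t \in B)) ?ltxx// => t.
  case: (boolP (t \in B)) => //= tB; apply/eqP => tM.
  by apply: (noA t); rewrite !inE /= tB tM eqxx.
exists A; split.
- by rewrite cardfs_gt0; apply/fset0Pn; exists t.
- by move=> u; rewrite !inE /= => /andP[_ /eqP ->].
- case hA : (ohead A) => [u|]; first by exists u, A.
  by move: tA hA; rewrite -[t \in A]/(t \in enum_fset A); case: (enum_fset A).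
Qed.
End Levels.
End Refinements.

(** * Operations on refinements *)

Section Combinators.
Variable X : topologicalType.
Local Open Scope ring_scope.

Lemma shrinking_set0 (T : Type) (O : T -> set X) : shrinking O (fun _ => set0).
Proof. by split => [t|t x|//] //; exact: fo_set0. Qed.

(** Families of index [d] or more do not help to cover [S], so they can be replaced by empty
    ones. *)
Lemma refinable_head (T : Type) d (S : set X) (P P' : nat -> T -> set X) :
  (forall j t, (j < d)%N -> P j t `<=` P' j t) ->
  refinable d S P -> refinable d S P'.
Proof.
move=> PP [G [Gs Gc]]; exists (fun j => if (j < d)%N then G j else fun _ => set0).
split; last by move=> x /Gc[j [t [jd ?]]]; exists j, t; rewrite jd.
move=> j; case: ifP => [jd|_]; last exact: shrinking_set0.
by have [? GP ?] := Gs j; split => // t x /GP /PP; apply.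
Qed.

Lemma refinable_mono (T : Type) d (S S' : set X) (P P' : nat -> T -> set X) :
  S' `<=` S -> (forall j t, P j t `<=` P' j t) ->
  refinable d S P -> refinable d S' P'.
Proof.
move=> SS PP [G [Gs Gc]]; exists G; split; last by move=> x /SS /Gc.
by move=> j; have [? GP ?] := Gs j; split => // t x /GP /PP.
Qed.

Lemma refinable_leq (T : Type) d d' (S : set X) (P : nat -> T -> set X) :
  (d <= d')%N -> refinable d S P -> refinable d' S P.
Proof.
move=> dd [G [Gs Gc]]; exists G; split => // x /Gc[j [t [jd ?]]].
by exists j, t; split => //; exact: leq_trans dd.
Qed.

Lemma refinable_set0 (T : Type) d (P : nat -> T -> set X) : refinable d set0 P.
Proof. by exists (fun _ _ => set0); split => // j; exact: shrinking_set0. Qed.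

(** The two sets use consecutive blocks of covers, so the numbers of families add up. *)
Lemma refinable_cat (T : Type) d d' (S S' : set X) (P : nat -> T -> set X) :
  refinable d S P -> refinable d' S' (fun j => P (d + j)%N) ->
  refinable (d + d') (S `|` S') P.
Proof.
move=> [G [Gs Gc]] [G' [Gs' Gc']].
exists (fun j => if (j < d)%N then G j else G' (j - d)%N); split.
  move=> j; case: ltnP => // dj; rewrite -{1}(subnKC dj); exact: Gs'.
move=> x [/Gc[j [t [jd ?]]]|/Gc'[j [t [jd ?]]]].
  by exists j, t; rewrite jd; split => //; exact: ltn_addr.
exists (d + j)%N, t; rewrite ltn_add2l; split => //.
by rewrite ltnNge leq_addr /= addKn.
Qed.

(* Composition of refinements: [e i `&` a i t] is still disjoint in [t] after the
   union over [i], since the [e i] are disjoint. *)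
Lemma refinable_comp (T : Type) d (S : set X) (O : nat -> nat -> set X)
    (P : nat -> T -> set X) (a : nat -> nat -> T -> set X) :
  (forall j i, shrinking (P j) (a j i)) ->
  (forall j i, O j i `<=` \bigcup_t a j i t) ->
  refinable d S O -> refinable d S P.
Proof.
move=> aP Oa [G [Gs Gc]]; exists (fun j t => \bigcup_i (G j i `&` a j i t)); split.
  move=> j; have [foG GO Ginj] := Gs j; split.
  - move=> t; apply: fo_bigcup_nat => i; apply: fo_setI => //.
    by case: (aP j i).
  - by move=> t x [i _ [_]]; case: (aP j i) => _ + _; apply.
  - move=> t u x [i _ [Gi ai]] [k _ [Gk ak]].
    by move: ak; rewrite -(Ginj _ _ _ Gi Gk); case: (aP j i) => _ _; apply.
move=> x /Gc[j [i [jd Gi]]].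
have [_ /(_ i x Gi) Oi _] := Gs j.
by have [t _ ait] := Oa _ _ _ Oi; exists j, t; split => //; exists i.
Qed.

(** [Z] serves to complete a family to a cover of [X]; missing [S], it can be discarded there. *)
Lemma refinable_drop0 d (S : set X) (Z : nat -> set X) (O : nat -> nat -> set X) :
  (forall j x, (j < d)%N -> S x -> ~ Z j x) ->
  refinable d S (fun j k => if k is k'.+1 then O j k' else Z j) ->
  refinable d S O.
Proof.
move=> ZS [G [Gs Gc]]; exists (fun j k => G j k.+1); split.
  move=> j; have [foG GO Ginj] := Gs j; split=> [t|t x /GO //|k l x Gk Gl]; first exact: foG.
  by have [] := Ginj _ _ _ Gk Gl.
move=> x Sx; have [j [[|k] [jd Gk]]] := Gc x Sx; last by exists j, k.
by have [_ /(_ _ _ Gk) /ZS ? _] := Gs j; exfalso; auto.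
Qed.

(** * Layers of a continuous function *)

Definition layer (h : X -> R) (i : nat) : set X :=
  [set x | i%:R <= h x <= i%:R + 1 / 2].

(** The open intervals from [i - 1/4] to [i + 3/4] are pairwise disjoint and leave a margin of 1/4
    around [[i, i + 1/2]]. *)
Definition layer_nbhd (h : X -> R) (i : nat) : set X :=
  [set x | i%:R - 1 / 4 < h x] `&` [set x | h x < i%:R + 3 / 4].

Lemma continuous_cst (c : R) : continuous (fun _ : X => c).
Proof. by move=> ?; exact: cvg_cst. Qed.

Lemma fo_gt (h : X -> R) c : continuous h -> fo [set x | c < h x].
Proof. by move=> ch; apply: fo_lt => //; exact: continuous_cst. Qed.

Lemma fo_gt_lt (h : X -> R) c c' : continuous h ->
  fo ([set x | c < h x] `&` [set x | h x < c']).
Proof.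
move=> ch; apply: fo_setI; first exact: fo_gt.
by apply: fo_lt => //; exact: continuous_cst.
Qed.

Lemma natr_lt1 (i j : nat) : i%:R < j%:R + 1 :> R -> (i <= j)%N.
Proof. by rewrite natr1 ltr_nat ltnS. Qed.

Lemma layer_nbhd_inj (h : X -> R) i j x :
  layer_nbhd h i x -> layer_nbhd h j x -> i = j.
Proof.
move=> [/= i1 i2] [/= j1 j2]; apply/eqP; rewrite eqn_leq.
by rewrite !natr_lt1 //; lra.
Qed.

Lemma layer_sub (h : X -> R) i : layer h i `<=` layer_nbhd h i.
Proof. by move=> x /= /andP[? ?]; split => /=; lra. Qed.

(** Cut down to the disjoint neighbourhoods, the families of all layers unite to disjoint ones;
    infinitely many layers cost no more families than one. *)
Lemma refinable_layers (T : Type) d (S : set X) (P : nat -> T -> set X) (h : X -> R) :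
  continuous h -> (forall i, refinable d (S `&` layer h i) P) ->
  refinable d (S `&` \bigcup_i layer h i) P.
Proof.
move=> ch /choice[G HG].
exists (fun j t => \bigcup_i (G i j t `&` layer_nbhd h i)); split.
  move=> j; split.
  - move=> t; apply: fo_bigcup_nat => i; apply: fo_setI; last exact: fo_gt_lt.
    by have [/(_ j)[]] := HG i.
  - by move=> t x [i _ [Gi _]]; have [/(_ j)[_ + _] _] := HG i; apply.
  - move=> t u x [i _ [Gi hi]] [k _ [Gk hk]].
    move: Gk; rewrite -(layer_nbhd_inj hi hk) => Gk.
    by have [/(_ j)[_ _ inj] _] := HG i; exact: inj Gi Gk.
move=> x [Sx [i _ hi]]; have [_ /(_ x (conj Sx hi))[j [t [jd Gi]]]] := HG i.
by exists j, t; split => //; exists i => //; split => //; exact: layer_sub.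
Qed.

Lemma continuous_addr (h : X -> R) (c : R) : continuous h -> continuous (fun x => h x + c).
Proof.
move=> ch; apply: continuous_near_le => x e e0.
apply: filterS (near_le_continuous ch x e0) => y.
by rewrite !ler_norml; lra.
Qed.

Lemma continuous_mull (h : X -> R) (c : R) : continuous h -> continuous (fun x => c * h x).
Proof. by move=> ch x; apply: (@cvgM R _ (nbhs x)); [exact: continuous_cst | exact: ch]. Qed.

Lemma layer_cover (h : X -> R) x : 0 <= h x ->
  (exists i, layer h i x) \/ exists i, layer (fun y => h y + 1 / 2) i x.
Proof.
move=> h0; have := truncn_itv h0; move: (Num.truncn _) => i.
rewrite -natr1 => /andP[? ?]; have [?|?] := leP (h x) (i%:R + 1 / 2).
  by left; exists i => /=; apply/andP.
(* Layer [i + 1] of [h + 1/2] is the band [i + 1/2 <= h <= i + 1] left over by the layers of [h]. *)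
by right; exists i.+1; rewrite /layer /= -(natr1 i); apply/andP; split; lra.
Qed.

Lemma refinable_half (T : Type) d d' (S : set X) (P : nat -> T -> set X) (h : X -> R) :
  continuous h -> (forall x, S x -> 0 <= h x) ->
  (forall i, refinable d (S `&` layer h i) P) ->
  (forall i, refinable d' (S `&` layer (fun y => h y + 1 / 2) i) (fun j => P (d + j)%N)) ->
  refinable (d + d') S P.
Proof.
move=> ch h0 H H'.
have := refinable_cat (refinable_layers ch H)
  (refinable_layers (continuous_addr (c := 1 / 2) ch) H').
apply: refinable_mono => [x Sx|j t x //].
by have [[i hi]|[i hi]] := layer_cover (h0 x Sx); [left|right]; split => //; exists i.
Qed.

(** * Covering dimension by means of two-element covers *)

Definition pair_cover (P : nat -> bool -> set X) : Prop :=
  (forall j b, fo (P j b)) /\ forall j x, exists b, P j b x.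

(* Covering dimension [< d] of [S] relative to [X], in the form of the theorem on
   partitions: any [d] two-element covers have disjoint refinements covering [S]. *)
Definition dim_lt (d : nat) (S : set X) : Prop :=
  forall P, pair_cover P -> refinable d S P.

Lemma dim_lt_mono d d' (S S' : set X) :
  (d <= d')%N -> S' `<=` S -> dim_lt d S -> dim_lt d' S'.
Proof.
move=> dd SS H P PC; apply: refinable_leq dd _.
by apply: refinable_mono (H P PC) => [|j t x].
Qed.

Lemma pair_cover_shift P d : pair_cover P -> pair_cover (fun j => P (d + j)%N).
Proof. by move=> [? ?]; split. Qed.

Lemma dim_lt_cat d d' (S S' : set X) :
  dim_lt d S -> dim_lt d' S' -> dim_lt (d + d') (S `|` S').
Proof.
move=> H H' P PC; apply: refinable_cat; first exact: H.
by apply: H'; exact: pair_cover_shift.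
Qed.

Lemma dim_lt_half d d' (S : set X) (h : X -> R) :
  continuous h -> (forall x, S x -> 0 <= h x) ->
  (forall i, dim_lt d (S `&` layer h i)) ->
  (forall i, dim_lt d' (S `&` layer (fun y => h y + 1 / 2) i)) ->
  dim_lt (d + d') S.
Proof.
move=> ch h0 H H' P PC; apply: (refinable_half ch h0) => i; first exact: H.
by apply: H'; exact: pair_cover_shift.
Qed.

(** Each member of [G] is assigned one index, and members with the same index are united. Local
    finiteness keeps the unions cozero; they are disjoint because a point lies in at most one
    member. *)
Lemma merge_shrinking (T : Type) (O : T -> set X) (G : set (set X)) :
  pairwise_disjoint_family G -> locally_finite_family G ->
  (forall U, G U -> fo U) -> (forall U, G U -> exists t, U `<=` O t) ->
  exists e : T -> set X, shrinking O e /\ forall U x, G U -> U x -> exists t, e t x.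
Proof.
move=> Gd Glf Gfo GO.
have /choice[c Hc] : forall U, exists o : option T,
    G U -> exists t, o = Some t /\ U `<=` O t.
  move=> U; have [/GO[t Ut]|?] := pselect (G U); last by exists None.
  by exists (Some t) => _; exists t.
pose O' t U := [set x | (G U /\ c U = Some t) /\ U x].
exists (fun t => \bigcup_U O' t U); split; first split.
- move=> t; apply: fo_bigcup_locally_finite => [U|x].
    have [GU|nGU] := pselect (G U /\ c U = Some t).
      rewrite (_ : O' t U = U); first by apply: Gfo; case: GU.
      by apply/seteqP; split => x // [].
    rewrite (_ : O' t U = set0); first exact: fo_set0.
    by apply/seteqP; split => x // [].
  have [N [Nx finN]] := Glf x; exists N; split => //.
  apply: sub_finite_set finN => U /= [y [[[GU _] Uy] Ny]].
  by split => //; exists y.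
- move=> t x [U _ [[GU cU] Ux]].
  by have [u [cu UO]] := Hc U GU; move: cU; rewrite cu => -[<-]; exact: UO.
- move=> t u x [U _ [[GU cU] Ux]] [V _ [[GV cV] Vx]].
  have UV : U = V.
    apply: contrapT => UV; have := Gd U V GU GV UV.
    by move=> /seteqP[/(_ x (conj Ux Vx))].
  by move: cU; rewrite UV cV => -[].
move=> U x GU Ux; have [t [ct _]] := Hc U GU.
by exists t, U.
Qed.

Lemma finite_locally_finite (G : set (set X)) : finite_set G -> locally_finite_family G.
Proof.
move=> finG x; exists setT; split; first exact: filterT.
by apply: sub_finite_set finG => U [].
Qed.

Lemma finite_C_refinable (T : Type) (O : nat -> T -> set X) :
  finite_C_space X -> (forall n t, fo (O n t)) ->
  (forall n, finite_set (range (O n))) -> (forall n x, exists t, O n t x) ->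
  exists s, refinable s setT O.
Proof.
move=> finC foO finO covO.
have [|s [gamma [[Hg covg] fing]]] := finC (fun n => range (O n)).
  move=> n; split => //; split; first by move=> _ [t _ <-].
  by move=> x; have [t Ot] := covO n x; exists (O n t); split => //; exists t.
have /choice[e He] : forall n, exists e : T -> set X, shrinking (O n) e /\
    ((n < s)%N -> forall U x, gamma n U -> U x -> exists t, e t x).
  move=> n; have [ns|sn] := ltnP n s; last first.
    by exists (fun _ => set0); split => //; exact: shrinking_set0.
  have [_ [gd gr]] := Hg n ns; have [gf gfo] := fing n ns.
  have [|e [? ?]] := @merge_shrinking _ (O n) (gamma n) gd (finite_locally_finite gf) gfo.
    by move=> U /gr[_ [[t _ <-] UO]]; exists t.
  by exists e.
exists s, e; split; first by move=> n; case: (He n).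
move=> x _; have [U [[n /= ns gU] Ux]] := covg x.
by have [_ /(_ ns U x gU Ux)[t et]] := He n; exists n, t.
Qed.
End Combinators.

(** * Finite dimension far out in a finite C-space *)

Section FiniteCSpaces.
Variable X : topologicalType.
Local Open Scope ring_scope.

Lemma not_refinable_all d (S : set X) : ~ dim_lt d S ->
  exists2 P, pair_cover P & ~ refinable d S P.
Proof.
by move=> /existsNP[P /not_implyP[? ?]]; exists P.
Qed.

(* If infinitely many layers had large dimension, the bad pairs on these layers could be
   glued, the layers being separated by gaps, to a sequence of bad pairs on [X]. *)
Lemma finite_C_layers (h : X -> R) : finite_C_space X -> continuous h ->
  exists m, forall i, (m <= i)%N -> dim_lt m (layer h i).
Proof.
move=> finC ch; apply: contrapT => /forallNP noM.
have bad m : exists2 i, (m <= i)%N & ~ dim_lt m (layer h i).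
  by have /existsNP[i /not_implyP[? ?]] := noM m; exists i.
(* One sequence per layer has to defeat every failing [m <= i]. The sequence for the largest such
   [m] does, since refinability persists when the number of families grows. *)
have /choice[tau Htau] : forall i, exists P : nat -> bool -> set X, pair_cover P /\
    forall m, (m <= i)%N -> ~ dim_lt m (layer h i) -> ~ refinable m (layer h i) P.
  move=> i; have [[m [mi nm]]|none] :=
      pselect (exists m, (m <= i)%N /\ ~ dim_lt m (layer h i)); last first.
    exists (fun _ _ => setT); split; first by split=> // [j b|j x]; [exact: fo_setT|exists true].
    by move=> m mi nm; case: none; exists m.
  have ex : exists m, (m <= i)%N && `[< ~ dim_lt m (layer h i) >].
    by exists m; rewrite mi; apply/asboolP.
  have bd : forall m, (m <= i)%N && `[< ~ dim_lt m (layer h i) >] -> (m <= i)%N.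
    by move=> k /andP[].
  have [k /andP[ki /asboolP /not_refinable_all[P PC nP]] kmax] := ex_maxnP ex bd.
  exists P; split => // l li nl /refinable_leq lP; apply: nP; apply: lP.
  by apply: kmax; rewrite li; apply/asboolP.
(* The complement of all layers: added to both members, it makes the glued pairs cover [X] without
   changing them on the layers. *)
pose gap := [set x | h x < 0] `|`
  \bigcup_i ([set x | (i%:R + 1 / 2) < h x] `&` [set x | h x < i%:R + 1]).
have fogap : fo gap.
  apply: fo_setU; first by apply: fo_lt => //; exact: continuous_cst.
  by apply: fo_bigcup_nat => i; exact: fo_gt_lt.
pose P j b := \bigcup_i (tau i j b `&` layer_nbhd h i) `|` gap.
have [|||s [G [Gs Gc]]] := @finite_C_refinable X bool P finC.
- move=> j b; apply: fo_setU => //; apply: fo_bigcup_nat => i.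
  apply: fo_setI; last exact: fo_gt_lt.
  by have [[foP _] _] := Htau i.
- by move=> j; apply: finite_image; exact: finite_finset.
- move=> j x; have [hx|hx] := ltP (h x) 0; first by exists true; right; left.
  have := truncn_itv hx; move: (Num.truncn _) => i; rewrite -natr1 => /andP[h1 h2].
  have [h3|h3] := leP (h x) (i%:R + 1 / 2).
    have [[_ /(_ j x)[b tb]] _] := Htau i; exists b; left; exists i => //; split => //.
    by apply: layer_sub; apply/andP.
  by exists true; right; right; exists i.
have [i si nd] := bad s; have [[foP PC] /(_ s si nd)] := Htau i; apply.
(* [G] refines only the glued pairs; intersecting with [tau i] loses no point of layer [i]. *)
exists (fun j b => G j b `&` tau i j b); split.
  move=> j; have [foG _ Ginj] := Gs j; split.
  - by move=> b; exact: fo_setI.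
  - by move=> b x [].
  - by move=> b c x [Gb _] [Gc' _]; exact: Ginj Gb Gc'.
move=> x hix; have [j [b [js Gjb]]] := Gc x I; exists j, b; split => //; split => //.
have [_ /(_ b x Gjb) Pjb _] := Gs j.
move: (hix) => /andP[h1 h2].
case: Pjb => [[k _ [tk hk]]|[/= h0|[k _ [/= h3 h4]]]].
- by rewrite (layer_nbhd_inj (layer_sub hix) hk).
- by have i0 := ler0n R i; exfalso; lra.
- have ki : (k <= i)%N by apply: natr_lt1; lra.
  have ik : (i <= k)%N by apply: natr_lt1; lra.
  by have E : i = k; [apply/eqP; rewrite eqn_leq ik | subst k; exfalso; lra].
Qed.

(** Far out, the layers of [h] and those of [h + 1/2] have bounded dimension, and together they fill
    the set. *)
Lemma finite_C_dim_lt (h : X -> R) : finite_C_space X -> continuous h ->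
  exists (c : R) d, dim_lt d [set x | c <= h x].
Proof.
move=> finC ch; have ch' := continuous_addr (c := 1 / 2) ch.
have [m Hm] := finite_C_layers finC ch.
have [n Hn] := finite_C_layers finC ch'.
have key (g : X -> R) k c : (forall i, (k <= i)%N -> dim_lt k (layer g i)) ->
    (forall x, c <= h x -> k%:R + 1 <= g x) ->
    forall i, dim_lt k ([set x | c <= h x] `&` layer g i).
  move=> Hk hg i; have [/Hk|ik] := leqP k i.
    by apply: dim_lt_mono => // x [].
  move=> Q _; apply: refinable_mono (refinable_set0 k Q) => [x|j t x //].
  move=> [/= /hg gx /andP[_ gi]].
  have : i.+1%:R <= k%:R :> R by rewrite ler_nat.
  by rewrite -natr1 => ?; exfalso; lra.
(* The summand 1 keeps the set clear of the layers of [h] below [m] and of [h + 1/2] below [n],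
   whose dimension is not controlled. *)
exists ((maxn m n)%:R + 1), (m + n)%N.
have [mM nM] : m%:R <= (maxn m n)%:R :> R /\ n%:R <= (maxn m n)%:R :> R.
  by rewrite !ler_nat leq_maxl leq_maxr.
apply: (dim_lt_half ch).
- by move=> x /=; have := ler0n R (maxn m n); lra.
- by apply: key => // x; lra.
- by apply: key => // x; lra.
Qed.

(** * Finite and countable covers over finite-dimensional sets *)

Lemma words_le n m : exists L : seq (seq nat),
  forall s, size s = n -> all (fun k => (k < m)%N) s -> s \in L.
Proof.
elim: n => [|n [L HL]]; first by exists [:: [::]] => s /size0nil ->.
exists [seq k :: s | k <- iota 0 m, s <- L] => -[//|k s] [sn] /= /andP[km sm].
by apply: allpairs_f; [rewrite mem_iota | exact: HL].
Qed.

Definition fo_cover (T : Type) (U : T -> set X) : Prop :=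
  (forall k, fo (U k)) /\ forall x, exists k, U k x.

(* Hemmingsen's argument: the two-element covers attached to all indices but the first
   cut down their members, and the first member keeps, on [S], only the lower sides. *)
Lemma shrink_tuple d (S : set X) (s : seq nat) (U : nat -> set X) :
  dim_lt d S -> fo (~` S) -> size s = d.+1 -> uniq s -> fo_cover U ->
  exists W, [/\ fo_cover W, forall k, W k `<=` U k &
    forall x, S x -> ~ (forall k, k \in s -> W k x)].
Proof.
case: s => // k0 s dS foS [sd] /= /andP[k0s us] [foU covU].
have [f [fE Uf _]] := equicontinuous_countable foU.
have f01 : forall k x, 0 <= f k x <= 1 by case: fE.
pose M := supf f setT.
have cM : continuous M by exact: supf_continuous.
have cf k : continuous (f k).
  apply: continuous_near_le => x e e0; case: fE => _ /(_ x e e0).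
  by apply: filterS => y; apply.
have fM k x : f k x <= M x by exact: supf_ge.
have M0 x : 0 < M x.
  by have [k /Uf fk] := covU x; exact: lt_le_trans fk (fM k x).
(* Thresholds at 1/3 and 2/3 of [M]: [hi k] and [lo k] cover [X], [top k] misses [lo k], and the
   sets [top k] cover [X] because some [f k x] comes close to [M x]. *)
pose hi k : set X := [set x | M x < 3 * f k x].
pose lo k : set X := [set x | 3 * f k x < 2 * M x].
pose top k : set X := [set x | 2 * M x < 3 * f k x].
have fohi k : fo (hi k) by apply: fo_lt => //; exact: continuous_mull.
have folo k : fo (lo k) by apply: fo_lt; exact: continuous_mull.
have fotop k : fo (top k) by apply: fo_lt; exact: continuous_mull.
have topU k : top k `<=` U k by move=> x; rewrite /top /= Uf; have := M0 x; lra.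
have hiU k : hi k `<=` U k by move=> x; rewrite /hi /= Uf; have := M0 x; lra.
have [|G [Gs Gc]] := dS (fun j b => if b then hi (nth 0%N s j) else lo (nth 0%N s j)).
  split=> [j []//|j x]; have [?|?] := ltP (M x) (3 * f (nth 0%N s j) x).
    by exists true.
  by exists false; rewrite /lo /=; have := M0 x; lra.
pose V := \bigcup_j (G j false `&` [set _ | (j < d)%N]).
have foV : fo V.
  apply: fo_bigcup_nat => j; have [jd|dj] := ltnP j d.
    rewrite (_ : _ `&` _ = G j false); first by have [] := Gs j.
    by apply/seteqP; split => x // [].
  rewrite (_ : _ `&` _ = set0); first exact: fo_set0.
  by apply/seteqP; split => x // [].
(* A point of [S] in all members of the tuple would lie in some [G j false], hence outside
   [G j true] and, being in [lo], outside the corresponding [top]. *)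
exists (fun k => if k \in s then G (index k s) true `|` top k
  else if k == k0 then U k0 `&` (~` S `|` V) else U k); split.
- split.
    move=> k; case: ifP => _.
      by apply: fo_setU => //; have [] := Gs (index k s).
    by case: ifP => _ //; apply: fo_setI => //; exact: fo_setU.
  move=> x; have [k _ topk] : exists2 k, setT k & 2 / 3 * M x < f k x.
    by apply: supf_gt; have := M0 x; rewrite -/M; lra.
  have {}topk : top k x by rewrite /top /=; lra.
  have [ks|ks] := boolP (k \in s); first by exists k; rewrite ks; right.
  have [kk0|kk0] := eqVneq k k0; last by exists k; rewrite (negbTE ks) (negbTE kk0); exact: topU.
  have [Sx|nSx] := pselect (S x); last first.
    by exists k0; rewrite (negbTE k0s) eqxx; split; [rewrite -kk0; exact: topU|left].
  have [j [[] [jd Gj]]] := Gc x Sx.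
    exists (nth 0%N s j); rewrite mem_nth ?sd// index_uniq ?sd//; by left.
  exists k0; rewrite (negbTE k0s) eqxx; split; first by rewrite -kk0; exact: topU.
  by right; exists j.
- move=> k x; case: ifP => [ks|_]; last by case: ifP => // /eqP -> [].
  case=> [Gx|/topU //]; have [_ /(_ true x Gx) + _] := Gs (index k s).
  by rewrite /= nth_index// => /hiU.
- move=> x Sx H; have := H k0; rewrite mem_head (negbTE k0s) eqxx => /(_ isT)[_].
  case=> // -[j _ [Gj jd]].
  have js : nth 0%N s j \in s by rewrite mem_nth ?sd.
  have := H (nth 0%N s j); rewrite inE js orbT => /(_ isT).
  have [_ GP Ginj] := Gs j; rewrite index_uniq ?sd//.
  case=> [Gt|]; first by have := Ginj _ _ _ Gj Gt.
  by have := GP false x Gj; rewrite /lo /top /=; lra.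
Qed.

(** Further shrinking cannot create new intersections, so the tuples are treated one after
    another. *)
Lemma shrink_tuples d (S : set X) (L : seq (seq nat)) (U : nat -> set X) :
  dim_lt d S -> fo (~` S) -> fo_cover U ->
  exists W, [/\ fo_cover W, forall k, W k `<=` U k &
    forall s, s \in L -> size s = d.+1 -> uniq s ->
    forall x, S x -> ~ (forall k, k \in s -> W k x)].
Proof.
move=> dS foS covU; elim: L => [|s L [W [covW WU WL]]]; first by exists U; split => // k x.
have [[sd us]|ns] := pselect (size s = d.+1 /\ uniq s); last first.
  exists W; split => // t; rewrite inE => /orP[/eqP ->|/WL //] sd us.
  by case: ns.
have [W' [covW' WW' Ws]] := shrink_tuple dS foS sd us covW.
exists W'; split => // [k|t]; first exact: subset_trans (WW' k) (WU k).
rewrite inE => /orP[/eqP -> _ _ //|tL td ut x Sx H].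
by apply: (WL t tL td ut x Sx) => k /H /WW'.
Qed.

(** Once no [d + 1] distinct members meet on [S], only levels of size at most [d] occur at its
    points. *)
Lemma refinable_finite_cover d (S : set X) (U : nat -> set X) m :
  dim_lt d S -> fo (~` S) -> fo_cover U -> (forall k x, U k x -> (k < m)%N) ->
  refinable d S (fun _ => U).
Proof.
move=> dS foS covU Um; have [L HL] := words_le d.+1 m.
have [W [[foW covW] WU WL]] := shrink_tuples L dS foS covU.
have [f [fE Wf _]] := equicontinuous_countable foW.
(* Level 0 is empty, so the sizes from 1 to [d] are shifted to the positions below [d]. *)
exists (fun j => level f j.+1); split.
  move=> j; have [? lf ?] := level_shrinking fE j.+1; split => // k x /lf.
  by move=> /Wf /WU.
move=> x Sx; have [||A [A0 AW [k Ak]]] := @level_cover X _ f fE x.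
- apply: sub_finite_set (finite_II m) => k /= /Wf /WU; exact: Um.
- by have [k /Wf ?] := covW x; exists k.
exists #|` A|.-1%fset, k; rewrite (prednK A0); split => //.
rewrite leqNgt; apply/negP => dA.
have memA u : u \in take d.+1 A -> u \in A by exact: mem_take.
apply: (WL (take d.+1 A) _ _ _ x Sx).
- apply: HL; first exact: size_takel.
  by apply/allP => u /memA /AW /Wf /WU; exact: Um.
- exact: size_takel.
- exact: take_uniq (fset_uniq A).
- by move=> u /memA /AW /Wf.
Qed.

(** The height is the reciprocal of the supremum of the truncated witnesses. As
    [f k <= 1 / (k + 1)], a small height forces a member of small index. *)
Lemma countable_cover_height (O : nat -> set X) : fo_cover O ->
  exists h : X -> R, [/\ continuous h, forall x, 0 <= h x &
    forall c : R, exists N : nat, forall x, h x <= c -> exists2 k, (k < N)%N & O k x].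
Proof.
move=> [foO covO]; have [f [fE Of fn]] := equicontinuous_countable foO.
have f01 : forall k x, 0 <= f k x <= 1 by case: fE.
pose M := supf f setT.
have M0 x : 0 < M x.
  by have [k /Of fk] := covO x; apply: lt_le_trans fk _; exact: supf_ge.
exists (fun x => (M x)^-1); split.
- move=> x; apply: (@cvgV R^o _ (nbhs x)); first by rewrite gt_eqF.
  exact: supf_continuous.
- by move=> x; rewrite invr_ge0 ltW.
- move=> c; exists (Num.truncn c).+1 => x hc.
  have c0 : 0 < c by apply: lt_le_trans hc; rewrite invr_gt0.
  have cM : c^-1 <= M x by rewrite -[M x]invrK lef_pV2 ?posrE ?invr_gt0.
  (* Extracting an index from the supremum needs a strict inequality, hence [c + 1]; the bound on
     [f k] still gives [k < c]. *)
  have [k _ fk] : exists2 k, setT k & (c + 1)^-1 < f k x.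
    apply: supf_gt; first by rewrite invr_ge0; lra.
    by apply: lt_le_trans cM; rewrite ltf_pV2 ?posrE; lra.
  exists k; last by rewrite Of; apply: lt_trans fk; rewrite invr_gt0; lra.
  have : (c + 1)^-1 < k.+1%:R^-1 by exact: lt_le_trans (fn k x).
  rewrite ltf_pV2 ?posrE ?ltr0n//; last by lra.
  rewrite -natr1 ltrD2r => kc; rewrite ltnS.
  by rewrite truncn_ge_nat; [exact: ltW | exact: ltW].
Qed.

(* Each layer of the height function meets finitely many members of the cover. *)
Lemma refinable_countable_cover d (B : set X) (O : nat -> set X) :
  dim_lt d B -> fo (~` B) -> fo_cover O -> refinable (d + d) B (fun _ => O).
Proof.
move=> dB foB covO; have [h [ch h0 hO]] := countable_cover_height covO.
have key (g : X -> R) : continuous g -> (forall x, h x <= g x) ->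
    forall i, refinable d (B `&` layer g i) (fun _ => O).
  move=> cg hg i; have [N HN] := hO (i%:R + 1 / 2).
  (* The complement of the layer, at index 0, completes the finitely many members that cover the
     layer to a cover of [X]. *)
  apply: (@refinable_drop0 _ _ _ (fun _ => ~` layer g i)) => [j x _ [_ gi] //|].
  have foL : fo (~` layer g i).
    rewrite (_ : ~` _ = [set x | g x < i%:R] `|` [set x | i%:R + 1 / 2 < g x]).
      by apply: fo_setU; [apply: fo_lt => //; exact: continuous_cst | exact: fo_gt].
    apply/seteqP; split => x /=.
      move=> H; have [?|?] := ltP (g x) i%:R; first by left.
      by right; rewrite ltNge; apply/negP => ?; apply: H; apply/andP.
    by move=> H /andP[? ?]; case: H; lra.
  pose O' k := if k is k'.+1 then (if (k' < N)%N then O k' else set0) else ~` layer g i.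
  have : refinable d (B `&` layer g i) (fun _ => O').
    apply: (@refinable_finite_cover _ _ _ N.+1).
    - by apply: dim_lt_mono dB => // x [].
    - by rewrite setCI; exact: fo_setU.
    - split=> [[//|k] /=|x].
        by case: ifP => _; [case: covO | exact: fo_set0].
      have [gi|] := pselect (layer g i x); last by exists 0%N.
      have [|k kN Ok] := HN x; last by exists k.+1; rewrite /= kN.
      by move/andP: gi => [_]; apply: le_trans.
    - by move=> [//|k] x /=; case: ltnP.
  apply: refinable_mono => // j [|k] x //=.
  by case: ifP.
apply: (refinable_half ch) => //; apply: key => //.
  exact: continuous_addr.
by move=> x; lra.
Qed.
End FiniteCSpaces.

(** * Locally finite cozero covers and the two implications *)

Section FamiliesOfSets.
Variable X : topologicalType.

Definition cozero_cover (F : set (set X)) : Prop :=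
  locally_finite_family F /\ (forall U, F U -> fo U) /\ is_cover F.

(* A family of sets indexed by itself; indices outside [F] stand for the empty set. *)
Definition self_indexed (F : set (set X)) (U : set X) : set X :=
  [set x | F U /\ U x].

Lemma fo_self_indexed (F : set (set X)) U :
  (forall U, F U -> fo U) -> fo (self_indexed F U).
Proof.
move=> foF; have [FU|nFU] := pselect (F U).
  rewrite (_ : self_indexed F U = U); first exact: foF.
  by apply/seteqP; split => x // [].
rewrite (_ : self_indexed F U = set0); first exact: fo_set0.
by apply/seteqP; split => x // [].
Qed.

Lemma shrinking_image (F : set (set X)) e : shrinking (self_indexed F) e ->
  [/\ forall W, (e @` F) W -> fo W, pairwise_disjoint_family (e @` F) &
      refines (e @` F) F].
Proof.
move=> [foe eF einj]; split.
- by move=> _ [U _ <-].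
- move=> _ _ [U _ <-] [V _ <-] UV; apply/seteqP; split => // x [eU eV].
  by case: UV; rewrite (einj _ _ _ eU eV).
- by move=> _ [U FU <-]; exists U; split => // x /eF[].
Qed.

Lemma locally_finite_shrinking (F : set (set X)) e :
  locally_finite_family F -> shrinking (self_indexed F) e ->
  locally_finite_family (e @` F).
Proof.
move=> lfF [_ eF _] x; have [N [Nx finN]] := lfF x; exists N; split => //.
apply: sub_finite_set (finite_image e finN) => _ [[U FU <-] [y [eUy Ny]]].
by exists U => //; split => //; exists y; split => //; case: (eF _ _ eUy).
Qed.

Lemma locally_finite_bigcup s (gamma : nat -> set (set X)) :
  (forall n, (n < s)%N -> locally_finite_family (gamma n)) ->
  locally_finite_family (\bigcup_(n in [set n : nat | (n < s)%N]) gamma n).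
Proof.
move=> lf x.
have /choice[N HN] : forall n, exists N : set X, nbhs x N /\
    ((n < s)%N -> finite_set [set U | gamma n U /\ U `&` N !=set0]).
  move=> n; have [ns|sn] := ltnP n s; last by exists setT; split=> //; exact: filterT.
  by have [N [? ?]] := lf n ns x; exists N.
exists [set y | forall n, `I_s n -> N n y]; split.
  by apply: near_finite_set; [exact: finite_II | move=> n _; case: (HN n)].
apply: sub_finite_set (bigcup_finite (finite_II s) (F := fun n =>
  [set U | gamma n U /\ U `&` N n !=set0]) _).
  move=> U [[n ns gU] [y [Uy Ny]]]; exists n => //; split => //.
  by exists y; split => //; exact: Ny.
by move=> n ns; case: (HN n) => _; apply.
Qed.

Lemma cozero_cover_meet (F G : set (set X)) : cozero_cover F -> cozero_cover G ->
  cozero_cover [set U `&` V | U in F & V in G].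
Proof.
move=> [lfF [foF covF]] [lfG [foG covG]]; split; [|split].
- move=> x; have [M [Mx finM]] := lfF x; have [N [Nx finN]] := lfG x.
  exists (M `&` N); split; first exact: filterI.
  apply: sub_finite_set (finite_image2 (fun U V => U `&` V) finM finN).
  move=> _ [[U FU [V GV <-]] [y [[Uy Vy] [My Ny]]]].
  by exists U; [split => //; exists y | exists V => //; split => //; exists y].
- by move=> _ [U FU [V GV <-]]; apply: fo_setI; [exact: foF | exact: foG].
- move=> x; have [U [FU Ux]] := covF x; have [V [GV Vx]] := covG x.
  by exists (U `&` V); split => //; exists U => //; exists V.
Qed.

(** These common refinements let a cover of larger index stand in for any earlier one. *)
Fixpoint iterated_meet (omega : nat -> set (set X)) (n : nat) : set (set X) :=
  if n is n'.+1 then [set U `&` V | U in iterated_meet omega n' & V in omega n]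
  else omega 0%N.

Lemma cozero_cover_iterated_meet omega n :
  (forall n, cozero_cover (omega n)) -> cozero_cover (iterated_meet omega n).
Proof. by move=> H; elim: n => [|n IH] /=; [exact: H | exact: cozero_cover_meet]. Qed.

Lemma iterated_meet_refines omega n m :
  (n <= m)%N -> refines (iterated_meet omega m) (omega n).
Proof.
elim: m => [|m IH]; first by rewrite leqn0 => /eqP -> U ?; exists U; split.
rewrite leq_eqVlt => /orP[/eqP -> _ [U _ [V ? <-]]|/IH H _ [U /H[V [? UV]] [W _ <-]]].
  by exists V; split => // x [].
by exists V; split => // x [/UV].
Qed.

(** The levels trade local finiteness for countability: each is a disjoint family, and their unions
    form a countable cover. *)
Lemma cozero_cover_levels (F : set (set X)) : cozero_cover F ->
  exists a : nat -> set X -> set X, (forall i, shrinking (self_indexed F) (a i)) /\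
    fo_cover (fun i => \bigcup_U a i U).
Proof.
move=> [lfF [foF covF]].
have [||f [fE fF]] := @equicontinuous_locally_finite X (set X) (self_indexed F).
- by move=> U; exact: fo_self_indexed.
- move=> x; have [N [Nx finN]] := lfF x; exists N; split => //.
  by apply: sub_finite_set finN => U [y [[FU Uy] Ny]]; split => //; exists y.
exists (level f); split.
  move=> i; have [? lf ?] := level_shrinking fE i.
  by split => // U x /lf /fF.
split=> [i|x]; first exact: fo_bigcup_level.
have [||A [_ _ [U AU]]] := @level_cover X _ f fE x.
- have [N [Nx finN]] := lfF x; apply: sub_finite_set finN => U /= /fF[FU Ux].
  by split => //; exists x; split => //; exact: nbhs_singleton.
- by have [U [FU Ux]] := covF x; exists U; apply/fF.
- by exists #|` A|%fset, U.
Qed.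

(** The families obtained may be infinite; merging their members along the finite cover [omega n]
    makes them finite. *)
Lemma finite_C_of_locally_finite :
  (forall omega : nat -> set (set X), (forall n, cozero_cover (omega n)) ->
     exists (s : nat) (gamma : nat -> set (set X)),
       finite_C_refinement omega s gamma /\
       (forall n : nat, (n < s)%N -> forall U, gamma n U -> fo U) /\
       locally_finite_family (\bigcup_(n in [set n : nat | (n < s)%N]) gamma n)) ->
  finite_C_space X.
Proof.
move=> H omega Homega.
have [|s [gamma [[Hg covg] [gfo glf]]]] := H omega.
  move=> n; have [finn [? ?]] := Homega n.
  by split; [exact: finite_locally_finite | split].
have /choice[e He] : forall n, exists e : set X -> set X, (n < s)%N ->
    shrinking (self_indexed (omega n)) e /\
    forall U x, gamma n U -> U x -> exists t, e t x.
  move=> n; have [ns|sn] := ltnP n s; last by exists id.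
  have [_ [gd gr]] := Hg n ns.
  have [|||e He] := @merge_shrinking X _ (self_indexed (omega n)) (gamma n) gd.
  - move=> x; have [N [Nx finN]] := glf x; exists N; split => //.
    by apply: sub_finite_set finN => U [? ?]; split => //; exists n.
  - exact: gfo.
  - by move=> U /gr[V [? UV]]; exists V => x /UV.
  - by exists e.
exists s, (fun n => e n @` omega n); split; last first.
  move=> n ns; have [/shrinking_image[? _ _] _] := He n ns; split => //.
  by apply: finite_image; case: (Homega n).
split.
  move=> n ns; have [/shrinking_image[foe ? ?] _] := He n ns; split => // U /foe.
  exact: fo_open.
move=> x; have [U [[n ns gU] Ux]] := covg x.
have [[_ eO _] /(_ U x gU Ux)[V eV]] := He n ns.
exists (e n V); split => //; exists n => //; exists V => //.
by case: (eO _ _ eV).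
Qed.

Lemma locally_finite_of_finite_C (omega : nat -> set (set X)) :
  finite_C_space X -> (forall n, cozero_cover (omega n)) ->
  exists (s : nat) (gamma : nat -> set (set X)),
    finite_C_refinement omega s gamma /\
    (forall n : nat, (n < s)%N -> forall U, gamma n U -> fo U) /\
    locally_finite_family (\bigcup_(n in [set n : nat | (n < s)%N]) gamma n).
Proof.
move=> finC covo.
pose rho := iterated_meet omega.
have covr n : cozero_cover (rho n) by exact: cozero_cover_iterated_meet.
have /choice[a Ha] := fun n => cozero_cover_levels (covr n).
pose O n i := \bigcup_U a n i U.
have covO n : fo_cover (O n) by case: (Ha n).
have /choice[h Hh] := fun n => countable_cover_height (covO n).
have ch n : continuous (h n) by case: (Hh n).
have /choice[c Hc] : forall n, exists c, exists d, dim_lt d [set x | (c <= h n x)%R].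
  by move=> n; exact: finite_C_dim_lt.
have /choice[N HN] : forall n, exists N : nat, forall x, (h n x <= c n)%R ->
    exists2 k, (k < N)%N & O n k x.
  by move=> n; case: (Hh n).
pose far n := [set x | (c n < h n x)%R].
pose near_O n k := if (k < N n)%N then O n k else set0.
have [|||s Hs] := @finite_C_refinable X nat
    (fun n k => if k is k'.+1 then near_O n k' else far n) finC.
- move=> n [|k]; first exact: fo_gt.
  by rewrite /near_O; case: ifP => _; [case: (covO n) | exact: fo_set0].
- move=> n; pose U k := if k is k'.+1 then near_O n k' else far n.
  apply: sub_finite_set (finite_image U (finite_II (N n).+2)) => _ [k _ <-].
  have [kN|Nk] := ltnP k (N n).+2; first by exists k.
  exists (N n).+1; first exact: ltnSn.
  case: k Nk => //= k Nk; rewrite /near_O ltnn ltnNge.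
  by rewrite (ltnW (Nk : (N n < k)%N)).
- move=> n x; have [/HN[k kN Ok]|?] := leP (h n x) (c n); last by exists 0%N.
  by exists k.+1; rewrite /near_O kN.
(* A finite union of sets of finite dimension; outside [B s] no [far n] with [n < s] is met. *)
pose B m := [set x | exists2 n, (n < m)%N & (c n <= h n x)%R].
have [d dB] : exists d, dim_lt d (B s).
  elim: (s) => [|m [d dB]]; first exists 0%N; last have [d' dm] := Hc m.
    by move=> Q _; apply: refinable_mono (refinable_set0 0 Q) => // x [].
  exists (d + d')%N; apply: dim_lt_mono (dim_lt_cat dB dm) => // x [n].
  rewrite ltnS leq_eqVlt => /orP[/eqP ->|nm]; first by right.
  by left; exists n.
have foB : fo (~` B s).
  elim: (s) => [|m IH].
    rewrite (_ : ~` _ = setT); first exact: fo_setT.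
    by apply/seteqP; split => x //= _ [].
  rewrite (_ : ~` _ = ~` B m `&` [set x | (h m x < c m)%R]).
    by apply: fo_setI => //; apply: fo_lt => //; exact: continuous_cst.
  apply/seteqP; split => x /=.
    move=> nB; split; first by move=> [n nm ?]; apply: nB; exists n => //; exact: leqW.
    by rewrite ltNge; apply/negP => ?; apply: nB; exists m.
  move=> [nB hm] [n]; rewrite ltnS leq_eqVlt => /orP[/eqP ->|nm ?].
    by rewrite leNgt hm.
  by apply: nB; exists n.
pose P n := self_indexed (rho n).
pose last := (s + (d + d))%N.
(* All positions from [s] on use the single cover [rho last], whose levels give one countable cover
   for the set [B s]. As [n <= q n] for [n < last], refining [rho (q n)] implies refining
   [omega n]. *)
pose q n := if (n < s)%N then n else last.
have low : refinable s (~` B s) (fun n => P (q n)).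
  have : refinable s (~` B s) O.
    apply: (@refinable_mono _ _ _ (~` B s) _ near_O) => //.
      by move=> n k x; rewrite /near_O; case: ifP.
    apply: (@refinable_drop0 _ _ _ far) => [j x js nB fx|].
      by apply: nB; exists j => //; exact: ltW.
    by apply: refinable_mono Hs => [//|n [|k] x].
  move=> /(@refinable_comp _ _ _ _ _ P a) H.
  apply: refinable_head (H _ _) => [n U ns|n i|n i //]; first by rewrite /q ns.
  by case: (Ha n).
have high : refinable (d + d) (B s) (fun n => P (q (s + n)%N)).
  have := refinable_countable_cover dB foB (covO last).
  move=> /(@refinable_comp _ _ _ _ _ (fun _ => P last) (fun _ => a last)) H.
  apply: refinable_mono (H _ _) => [//|n U|n i|n i //].
    by rewrite /q ltnNge leq_addr.
  by case: (Ha last).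
have [e [es ec]] := refinable_cat low high.
have nq n : (n < last)%N -> (n <= q n)%N.
  by rewrite /q; case: ifP => // _ /ltnW.
exists last, (fun n => e n @` rho (q n)); split; last split.
- split.
    move=> n nl; have [foe ? er] := shrinking_image (es n); split => [U /foe|].
      exact: fo_open.
    split => // U /er[V [/(iterated_meet_refines (nq n nl))[W [? VW]] UV]].
    by exists W; split => //; exact: subset_trans UV VW.
  move=> x; have [|n [U [nl eU]]] := ec x.
    by have [?|?] := pselect (B s x); [right|left].
  have [_ eP _] := es n; exists (e n U); split => //; exists n => //; exists U => //.
  by case: (eP _ _ eU).
- by move=> n _ U; have [foe _ _] := shrinking_image (es n); exact: foe.
- apply: locally_finite_bigcup => n _; apply: locally_finite_shrinking (es n).
  by case: (covr (q n)).
Qed.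
End FamiliesOfSets.

Unset Implicit Arguments.

Theorem theorem2p4 (X : topologicalType) (hX : tychonoff_space X) :
  finite_C_space X <->
  (forall omega : nat -> set (set X),
     (forall n, locally_finite_family (omega n) /\
                (forall U, omega n U -> functionally_open U) /\
                is_cover (omega n)) ->
     exists (s : nat) (gamma : nat -> set (set X)),
       finite_C_refinement omega s gamma /\
       (forall n : nat, (n < s)%N -> forall U, gamma n U -> functionally_open U) /\
       locally_finite_family (\bigcup_(n in [set n : nat | (n < s)%N]) gamma n)).
Proof.
split=> [finC omega|]; first exact: locally_finite_of_finite_C.
exact: finite_C_of_locally_finite.
Qed.
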